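(* Let $b\in\mathbb N$, $b\ge2$, $0<p\le\infty$, and let $S\subset L^p([0,1))$ be a finite-dimensional linear subspace that is closed under $b$-adic dilation. Then the spaces $V_{b,d,S}$ form a hierarchy of subspaces of $L^p([0,1))$, $$S=V_{b,0,S}\subset V_{b,1,S}\subset V_{b,2,S}\subset\cdots,$$ and $V_{b,S}:=\bigcup_{d\in\mathbb N}V_{b,d,S}$ is a linear space. If in addition $S$ contains the constant function one and $1\le p<\infty$, then $V_{b,S}$ is dense in $L^p([0,1))$.
   Context: $I_b=\{0,\dots,b-1\}$. For $d\in\mathbb N$, $t_{b,d}:I_b^d\times[0,1)\to[0,1)$, $t_{b,d}(i_1,\dots,i_d,y)=\sum_{k=1}^d i_kb^{-k}+b^{-d}y$ (a bijection), and $T_{b,d}f=f\circ t_{b,d}$; $T_{b,0}$ is the identity. $\mathbf V_{b,d,S}=(\mathbb R^{I_b})^{\otimes d}\otimes S$ is identified with the space of functions $\boldsymbol f$ on $I_b^d\times[0,1)$ with all partial evaluations $\boldsymbol f(j_1,\dots,j_d,\cdot)\in S$, and $V_{b,d,S}=T_{b,d}^{-1}(\mathbf V_{b,d,S})$, i.e. $f\in V_{b,d,S}$ iff $f(b^{-d}(j+\cdot))\in S$ for all $0\le j<b^d$. $S$ is closed under $b$-adic dilation if for every $f\in S$ and $k\in\{0,\dots,b-1\}$ the function $x\mapsto f(b^{-1}(x+k))$ on $[0,1)$ belongs to $S$. *)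

(* Defs.v *)
From HB Require Import structures.
From mathcomp Require Import all_boot all_order all_algebra.
From mathcomp Require Import all_classical all_reals all_analysis measurable_realfun.

Set Implicit Arguments.
Unset Strict Implicit.
Unset Printing Implicit Defensive.

Import Order.TTheory GRing.Theory Num.Theory.
Import numFieldNormedType.Exports.

Local Open Scope classical_set_scope.
Local Open Scope ring_scope.
Local Open Scope quotient_scope.

(* Lebesgue measure on [0,1), as a measure on the whole real line: functions on
   [0,1) are represented by functions on R, whose values outside [0,1) are
   irrelevant because they are identified up to mu01-a.e. equality. *)
Definition mu01 (R : realType) : {measure set (measurableTypeR R) -> \bar R} :=
  mrestr lebesgue_measure (measurable_itv `[0, 1[).

(* Classes, modulo a.e. equality on [0,1), of measurable functions R -> R.  The
   coercion from classes to functions selects a representative. *)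
Definition M01 (R : realType) : Type :=
  {mfun_ mu01 R, measurableTypeR R >-> R}.

HB.instance Definition _ (R : realType) := Choice.on (M01 R).
HB.instance Definition _ (R : realType) := EqQuotient.on (M01 R).

Definition M01_fun (R : realType) (f : M01 R) : R -> R := aqEqMfun_to_fun f.
Coercion M01_fun : M01 >-> Funclass.

Definition cls (R : realType) (f : {mfun measurableTypeR R >-> R})
  : M01 R := \pi_(M01 R) f.

Lemma clsP (R : realType)
    (f g : {mfun measurableTypeR R >-> R}) :
  cls f = cls g <-> f = g %[ae mu01 R].
Proof.
rewrite /cls; split.
  by move/eqmodP/asboolP.
by move=> h; apply/eqmodP/asboolP.
Qed.


Section M01_lmodule.
Variable R : realType.
Implicit Types (f g h : M01 R) (u v : {mfun measurableTypeR R >-> R}) (a c : R).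

Definition M01_zero : M01 R := cls 0.
Definition M01_opp f : M01 R := cls (- repr f).
Definition M01_add f g : M01 R := cls (repr f + repr g).
Definition M01_scale a f : M01 R := cls (a *: repr f).

Lemma repr_cls u : repr (cls u) = u %[ae mu01 R].
Proof. by apply/clsP; rewrite /cls reprK. Qed.

Lemma cls_repr f : cls (repr f) = f.
Proof. exact: reprK. Qed.

Lemma clsD u v : M01_add (cls u) (cls v) = cls (u + v).
Proof.
apply/clsP; move: (repr_cls u) (repr_cls v); apply: filterS2 => x uE vE _.
by rewrite !mfunD /= uE// vE.
Qed.

Lemma clsN u : M01_opp (cls u) = cls (- u).
Proof.
apply/clsP; move: (repr_cls u); apply: filterS => x uE _.
by rewrite !mfunN /= uE.
Qed.

Lemma clsZ a u : M01_scale a (cls u) = cls (a *: u).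
Proof.
apply/clsP; move: (repr_cls u); apply: filterS => x uE _.
by rewrite -[LHS]/(a * repr (cls u) x) uE.
Qed.

Lemma M01_addA : associative M01_add.
Proof.
move=> f g h; rewrite -(cls_repr f) -(cls_repr g) -(cls_repr h).
by rewrite !clsD addrA.
Qed.

Lemma M01_addC : commutative M01_add.
Proof. by move=> f g; rewrite /M01_add addrC. Qed.

Lemma M01_add0 : left_id M01_zero M01_add.
Proof. by move=> f; rewrite -(cls_repr f) clsD add0r. Qed.

Lemma M01_addN : left_inverse M01_zero M01_opp M01_add.
Proof. by move=> f; rewrite -(cls_repr f) clsN clsD addNr. Qed.

HB.instance Definition _ :=
  GRing.isZmodule.Build (M01 R) M01_addA M01_addC M01_add0 M01_addN.

Lemma M01_scaleA a c f : M01_scale a (M01_scale c f) = M01_scale (a * c) f.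
Proof. by rewrite -(cls_repr f) !clsZ scalerA. Qed.

Lemma M01_scale1 : left_id 1 M01_scale.
Proof. by move=> f; rewrite -(cls_repr f) clsZ scale1r. Qed.

Lemma M01_scaleDr : right_distributive M01_scale +%R.
Proof.
move=> a f g; rewrite -(cls_repr f) -(cls_repr g).
by rewrite /+%R /= !(clsD, clsZ) scalerDr.
Qed.

Lemma M01_scaleDl f : {morph M01_scale^~ f : a c / a + c}.
Proof.
move=> a c; rewrite -(cls_repr f).
by rewrite [in RHS]/+%R /= !(clsD, clsZ) scalerDl.
Qed.

HB.instance Definition _ := GRing.Zmodule_isLmodule.Build R (M01 R)
  M01_scaleA M01_scale1 M01_scaleDr M01_scaleDl.

End M01_lmodule.

Definition Lpnorm (R : realType) (p : \bar R) (f : M01 R) : \bar R :=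
  ('N[mu01 R]_p[EFin \o f])%E.

Definition Lp (R : realType) (p : \bar R) : set (M01 R) :=
  [set f | (Lpnorm p f < +oo)%E].

Definition dense_in_Lp (R : realType) (p : \bar R) (A : set (M01 R)) : Prop :=
  A `<=` Lp p /\
  forall f, Lp p f -> forall e : R, 0 < e ->
    exists2 g, A g & (Lpnorm p (f - g)%R < e%:E)%E.

Definition finite_dim (R : realType) (V : lmodType R) (S : set V) : Prop :=
  exists (n : nat) (e : 'I_n -> V), (forall i, S (e i)) /\
    forall f, S f -> exists c : 'I_n -> R, f = \sum_(i < n) c i *: e i.

Section badic.
Variables (R : realType) (b : nat).

Definition dil (k : nat) (x : R) : R := b%:R^-1 * (x + k%:R).

(* The digits i_1, ..., i_d are indexed from 0, whence the exponent k.+1. *)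
Definition tmap (d : nat) (i : {ffun 'I_d -> 'I_b}) (y : R) : R :=
  \sum_(k < d) (i k)%:R * b%:R ^- k.+1 + b%:R ^- d * y.

Lemma measurable_dil k :
  measurable_fun [set: measurableTypeR R] (dil k : _ -> measurableTypeR R).
Proof.
apply: measurable_funM; first exact: measurable_cst.
by apply: measurable_funD; [exact: measurable_id|exact: measurable_cst].
Qed.

HB.instance Definition _ k := isMeasurableFun.Build _ _ _ _
  (dil k : measurableTypeR R -> measurableTypeR R) (measurable_dil k).

Lemma measurable_tmap d (i : {ffun 'I_d -> 'I_b}) :
  measurable_fun [set: measurableTypeR R] (tmap i : _ -> measurableTypeR R).
Proof.
apply: measurable_funD; first exact: measurable_cst.
by apply: measurable_funM; [exact: measurable_cst|exact: measurable_id].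
Qed.

HB.instance Definition _ d i := isMeasurableFun.Build _ _ _ _
  (@tmap d i : measurableTypeR R -> measurableTypeR R) (measurable_tmap i).

(* f \o phi on classes, computed on a representative; see Mcomp_cls. *)
Definition Mcomp (f : M01 R) (phi : {mfun measurableTypeR R >-> measurableTypeR R})
  : M01 R := cls (repr f \o phi).


Lemma lebesgue_affine (c s : R) (s0 : 0 < s) (A : set (measurableTypeR R)) :
  measurable A ->
  lebesgue_measure A =
  (s%:E * lebesgue_measure ((fun y => c + s * y)%R @^-1` A))%E.
Proof.
move=> mA.
have mphi : measurable_fun [set: measurableTypeR R]
    ((fun y => c + s * y) : measurableTypeR R -> measurableTypeR R).
  apply: measurable_funD; first exact: measurable_cst.
  by apply: measurable_funM; [exact: measurable_cst|exact: measurable_id].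
pose phi : measurableTypeR R -> measurableTypeR R := fun y => c + s * y.
pose m0 : {measure set (measurableTypeR R) -> \bar R} := pushforward lebesgue_measure phi.
pose m := mscale (NngNum (ltW s0)) (m0 mphi).
rewrite (@lebesgue_measure_unique R m) //= => X [[x y] _ <-].
have phiE : phi @^-1` `]x, y] = `](x - c) / s, (y - c) / s]%classic.
  apply/seteqP; split=> z; rewrite /= !in_itv /= ltr_pdivrMr// ler_pdivlMr//;
  by rewrite ltrBlDl lerBrDl mulrC.
transitivity (s%:E * lebesgue_measure (phi @^-1` `]x, y]))%E; last by [].
rewrite phiE !lebesgue_measure_itv /= !lte_fin ltr_pM2r ?invr_gt0// ltrD2r.
case: ifP => _; last by rewrite mule0.
rewrite -!EFinB -EFinM; congr EFin.
by rewrite -mulrBl mulrCA divff ?gt_eqF// mulr1 opprB addrA subrK.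
Qed.
(* Composition with phi does not depend on the representative when phi is
   affine, increasing and maps [0,1) into itself. *)
Lemma Mcomp_cls (u : {mfun measurableTypeR R >-> R})
    (phi : {mfun measurableTypeR R >-> measurableTypeR R}) (c s : R) :
  0 < s -> (forall y, phi y = c + s * y) ->
  (forall y : R, 0 <= y < 1 -> 0 <= phi y < 1) ->
  Mcomp (cls u) phi = cls (u \o phi).
Proof.
move=> s0 phiE phi01; apply/clsP.
have [N [mN N0 uN]] := repr_cls u.
have mI : measurable (`[0, 1[ : set (measurableTypeR R)).
  exact: measurable_itv.
have mphi A : measurable A -> measurable (phi @^-1` A).
  by move=> mA; rewrite -[X in measurable X]setTI; exact: measurable_funPT.
exists (phi @^-1` N); split; first exact: mphi.
- apply/eqP; rewrite -measure_le0 /mu01 /= /mrestr.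
  have <- : lebesgue_measure (phi @^-1` (N `&` `[0, 1[)) = 0%E.
    have := lebesgue_affine c s0 (measurableI _ _ mN mI).
    rewrite [LHS]N0 => /esym/eqP; rewrite mule_eq0 eqe gt_eqF//= => /eqP.
    by rewrite (_ : (fun y => _) = phi)//; apply/funext => y; rewrite phiE.
  apply: le_measure; rewrite ?inE.
  - by apply: measurableI => //; exact: mphi.
  - by apply: mphi; exact: measurableI.
  - by move=> y [Ny]; rewrite /= !in_itv /= => /phi01.
- by move=> y /= yN; apply: uN => /= uE; apply: yN => _; exact: uE.
Qed.

Lemma tmap01 d (i : {ffun 'I_d -> 'I_b}) (y : R) :
  0 <= y < 1 -> 0 <= tmap i y < 1.
Proof.
move=> /andP[y0 y1]; case: d i => [|d] i.
  by rewrite /tmap big_ord0 expr0 invr1 mul1r add0r y0.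
have b0 : (0 < b)%N by case: (i ord0) => m; exact: leq_ltn_trans.
have bV0 n : 0 < (b%:R ^- n : R) by rewrite invr_gt0 exprn_gt0 ?ltr0n.
apply/andP; split.
  rewrite addr_ge0 ?mulr_ge0 ?(ltW (bV0 _))//.
  by apply: sumr_ge0 => k _; rewrite mulr_ge0// ltW.
have geo n : \sum_(k < n) b.-1%:R * b%:R ^- k.+1 + b%:R ^- n = 1 :> R.
  elim: n => [|n IH]; first by rewrite big_ord0 expr0 invr1 add0r.
  rewrite big_ord_recr /= -addrA -[X in _ + (_ + X)]mul1r -mulrDl natr1.
  rewrite prednK// exprS invfM mulrA divff ?mul1r// pnatr_eq0.
  by rewrite -lt0n.
rewrite -(geo d.+1) ler_ltD//; last by rewrite gtr_pMr.
by apply: ler_sum => k _; rewrite ler_pM2r// ler_nat -ltnS prednK.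
Qed.

Lemma dil01 (k : 'I_b) (x : R) : 0 <= x < 1 -> 0 <= dil k x < 1.
Proof.
move=> /andP[x0 x1]; rewrite /dil.
have b0 : (0 < b)%N by case: k => m; exact: leq_ltn_trans.
rewrite mulr_ge0 ?addr_ge0 ?invr_ge0//=.
rewrite mulrC ltr_pdivrMr ?ltr0n// mul1r.
apply: (@lt_le_trans _ _ (k.+1)%:R); first by rewrite -natr1 addrC ltrD2l.
by rewrite ler_nat.
Qed.

(* A function on I_b^d x [0,1) is represented by the family, indexed by
   (i_1, ..., i_d), of its partial evaluations. *)
Definition Tmap (d : nat) (f : M01 R) : {ffun 'I_d -> 'I_b} -> M01 R :=
  fun i => Mcomp f (tmap i).

Lemma Tmap_cls d (i : {ffun 'I_d -> 'I_b}) (u : {mfun measurableTypeR R >-> R}) :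
  Tmap (cls u) i = cls (u \o tmap i).
Proof.
apply: (@Mcomp_cls u (tmap i) (\sum_(k < d) (i k)%:R * b%:R ^- k.+1)
  (b%:R ^- d)) => //; last exact: tmap01.
rewrite invr_gt0; case: d i => [|d] i; first by rewrite expr0.
by rewrite exprn_gt0// ltr0n; case: (i ord0) => m; exact: leq_ltn_trans.
Qed.

Lemma dil_cls (k : 'I_b) (u : {mfun measurableTypeR R >-> R}) :
  Mcomp (cls u) (dil k) = cls (u \o dil k).
Proof.
apply: (@Mcomp_cls u (dil k) (b%:R^-1 * k%:R) (b%:R^-1)) => [|y|y].
- by rewrite invr_gt0 ltr0n; case: k => m; exact: leq_ltn_trans.
- by rewrite -[LHS]/(b%:R^-1 * (y + k%:R)) mulrDr addrC.
- exact: dil01.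
Qed.

Definition dilation_closed (S : set (M01 R)) : Prop :=
  forall f, S f -> forall k : 'I_b, S (Mcomp f (dil k)).

(* The tensor space of functions on I_b^d x [0,1) with partial evaluations in S. *)
Definition bV (d : nat) (S : set (M01 R)) :
    set ({ffun 'I_d -> 'I_b} -> M01 R) :=
  [set F | forall i, S (F i)].

Definition V (d : nat) (S : set (M01 R)) : set (M01 R) :=
  @Tmap d @^-1` bV S.

Definition Vinf (S : set (M01 R)) : set (M01 R) := \bigcup_d V d S.

End badic.

(* Main.v *)
Require Import Defs.
From HB Require Import structures.
From mathcomp Require Import all_boot all_order all_algebra.
From mathcomp Require Import all_classical all_reals all_analysis measurable_realfun.
From mathcomp Require Import ess_sup_inf lra.

(** Everything is proved one digit at a time: [f] lies in [V b d.+1 S] iff all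
its dilates [f \o dil b k] lie in [V b d S], and Lebesgue measure on [0,1) is
the average of its images under the [b] maps [dil b k].  For density, truncate
[f] to [-M,M], approximate the truncation in L^1 by a continuous [g], and
sample the truncation of [g] on the grid of mesh [b^-n]; for functions bounded
by [M], convergence in L^1 gives convergence in L^p. *)

Import Order.TTheory GRing.Theory Num.Theory.
Import numFieldNormedType.Exports.
Local Open Scope classical_set_scope.
Local Open Scope ring_scope.

(** * The spaces V_{b,d,S}: nesting and linear structure *)

Section hierarchy.
Context {R : realType} {b : nat}.
Implicit Types (f g : M01 R) (S : set (M01 R)).

Lemma McompD_dil (k : 'I_b) (a : R) f g :
  Mcomp (a *: f + g) (dil b k) = a *: Mcomp f (dil b k) + Mcomp g (dil b k).
Proof.
rewrite -(cls_repr f) -(cls_repr g).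
have E (u v : {mfun measurableTypeR R >-> R}) : a *: cls u + cls v = cls (a *: u + v).
  by rewrite -clsD -clsZ.
by rewrite E !dil_cls E; congr cls; apply/mfuneqP => x.
Qed.

Lemma Mcomp0_dil (k : 'I_b) : Mcomp (0 : M01 R) (dil b k) = 0.
Proof. by rewrite -[0]/(cls 0) dil_cls; congr cls; apply/mfuneqP. Qed.

Lemma V0 S : V b 0 S = S.
Proof.
have T0 f i : @Tmap R b 0 f i = f.
  rewrite -(cls_repr f) Tmap_cls; congr cls; apply/mfuneqP => y /=.
  by rewrite /tmap big_ord0 expr0 invr1 mul1r add0r.
apply/seteqP; split => f; rewrite /V /bV /=; last by move=> Sf i; rewrite T0.
(* The empty multi-index is the only one of length 0; [Tmap] at it is the identity. *)
by move=> /(_ (finfun (fun i : 'I_0 => False_rect _ (notF (ltn_ord i))))); rewrite T0.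
Qed.

(* Peeling off the leading digit: t(i_1, ..., i_{d+1}, y) = dil i_1 (t(i_2, ..., i_{d+1}, y)). *)
Lemma V_succ d S f : V b d.+1 S f <-> forall k : 'I_b, V b d S (Mcomp f (dil b k)).
Proof.
have tE (k : 'I_b) (i : {ffun 'I_d.+1 -> 'I_b}) (j : {ffun 'I_d -> 'I_b}) :
    i ord0 = k -> (forall l, i (lift ord0 l) = j l) ->
    Tmap f i = Tmap (Mcomp f (dil b k)) j.
  move=> ik ij; rewrite -(cls_repr f) dil_cls !Tmap_cls; congr cls.
  apply/mfuneqP => y /=; congr (repr f _).
  rewrite /tmap /dil big_ord_recl ik expr1 !mulrDr mulr_sumr mulrA -invfM -exprS.
  rewrite -addrA addrC; congr (_ + _ + _); last exact: mulrC.
  by apply: eq_bigr => l _; rewrite ij mulrCA -invfM -exprS.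
split=> [Vf k j|Vf i].
  (* The multi-index with leading digit [k] followed by the digits of [j]. *)
  pose i : {ffun 'I_d.+1 -> 'I_b} := [ffun l => if unlift ord0 l is Some l' then j l' else k].
  rewrite -(tE k i j); [exact: Vf | by rewrite ffunE unlift_none|].
  by move=> l; rewrite ffunE liftK.
rewrite (tE (i ord0) i [ffun l => i (lift ord0 l)])//; first exact: Vf.
by move=> l; rewrite ffunE.
Qed.

(** Closure under dilation is precisely the inclusion at d = 0; peeling off the leading digit
    carries it to every d. *)
Lemma V_subset d S : dilation_closed b S -> V b d S `<=` V b d.+1 S.
Proof.
move=> Sdil; elim: d => [|d IH] f.
  by rewrite V_succ V0 => Sf k; exact: Sdil.
by move=> /V_succ Vf; apply/V_succ => k; exact: IH.
Qed.

Lemma V_submod_closed d S : submod_closed (mem S) -> submod_closed (mem (V b d S)).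
Proof.
move=> Slin; elim: d => [|d [IH0 IHD]]; first by rewrite V0.
split.
  by rewrite inE; apply/V_succ => k; rewrite Mcomp0_dil -inE.
move=> a f g; rewrite !inE => /V_succ Vf /V_succ Vg; apply/V_succ => k.
by rewrite McompD_dil -in_setE; apply: IHD; rewrite inE.
Qed.

(** The union is over an increasing chain, so two elements of levels d and e already lie together in
    the subspace of level [maxn d e]. *)
Lemma Vinf_submod_closed S :
  dilation_closed b S -> submod_closed (mem S) -> submod_closed (mem (Vinf b S)).
Proof.
move=> Sdil Slin.
have mono d e : (d <= e)%N -> V b d S `<=` V b e S.
  move=> /subnK <-; elim: (e - d)%N => [//|n IH] f Vf.
  by rewrite addSn; apply: V_subset => //; exact: IH.
split; first by rewrite inE; exists 0%N => //; rewrite V0 -inE; exact: Slin.1.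
move=> a f g; rewrite !inE => -[d _ Vf] [e _ Vg]; exists (maxn d e) => //.
rewrite -in_setE; apply: (V_submod_closed _ _ Slin).2; rewrite inE.
  by apply: mono Vf; exact: leq_maxl.
by apply: mono Vg; exact: leq_maxr.
Qed.

End hierarchy.

(** * Lebesgue measure and L^p norms on [0,1) under the dilations *)

Section self_similarity.
Context {R : realType}.
Local Notation mu01 := (mu01 R).
Local Notation leb := (@lebesgue_measure R).

Lemma ae_eq_Lnorm (p : \bar R) (u v : {mfun measurableTypeR R >-> R}) :
  p != -oo%E -> u = v %[ae mu01] -> ('N[mu01]_p[EFin \o u] = 'N[mu01]_p[EFin \o v])%E.
Proof.
case: p => [r _|_|//] uv; rewrite unlock /Lnorm.
  congr poweR; apply: ge0_ae_eq_integral => //.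
  - apply: (measurableT_comp (measurable_poweR _)).
    by apply: measurableT_comp => //; apply/measurable_EFinP.
  - apply: (measurableT_comp (measurable_poweR _)).
    by apply: measurableT_comp => //; apply/measurable_EFinP.
  - by move=> x _; exact: poweR_ge0.
  - by move=> x _; exact: poweR_ge0.
  - by apply: filterS uv => x /(_ I) /= ->.
case: ifPn => // _; apply: eq_ess_sup.
by apply: filterS uv => x /(_ I) /= ->.
Qed.

(** Allows the norm of a class to be computed on any chosen representative. *)
Lemma Lpnorm_cls (p : \bar R) (u : {mfun measurableTypeR R >-> R}) :
  p != -oo%E -> (Lpnorm p (cls u) = 'N[mu01]_p[EFin \o u])%E.
Proof. by move=> pNy; apply: ae_eq_Lnorm => //; exact: repr_cls. Qed.

(** The maps [dil b k] send [0,1) onto the b cells [k/b, (k+1)/b), which partition [0,1), and each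
    contracts lengths by 1/b. *)
Lemma mu01_dil (b : nat) (A : set (measurableTypeR R)) : (0 < b)%N -> measurable A ->
  mu01 A = (\sum_(k < b) (b%:R^-1)%:E * mu01 (dil b k @^-1` A))%E.
Proof.
move=> b0 mA.
have bV0 : 0 < (b%:R^-1 : R) by rewrite invr_gt0 ltr0n.
(* The cells are appended one at a time, for every n; n = b then fills [0,1). *)
have part n : leb (A `&` `[0, n%:R / b%:R[) =
    (\sum_(k < n) (b%:R^-1)%:E * mu01 (dil b k @^-1` A))%E.
  elim: n => [|n IH].
    by rewrite big_ord0 mul0r set_itvco0 setI0 measure0.
  have nb : n%:R / b%:R <= n.+1%:R / b%:R :> R by rewrite ler_pM2r// ler_nat.
  rewrite big_ord_recr /= -IH.
  have -> : `[0, n.+1%:R / b%:R[%classic =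
      `[0, n%:R / b%:R[ `|` `[n%:R / b%:R, n.+1%:R / b%:R[ :> set R.
    by rewrite -itv_bndbnd_setU// bnd_simp// divr_ge0.
  rewrite setIUr measureU//; last 3 first.
  - by apply: measurableI => //; exact: measurable_itv.
  - by apply: measurableI => //; exact: measurable_itv.
  - apply/seteqP; split=> // x [[_]] /=; rewrite !in_itv /= => /andP[_ xn] [_].
    by rewrite leNgt xn.
  congr (_ + _)%E.
  etransitivity.
    apply: (lebesgue_affine (n%:R / b%:R) bV0).
    by apply: measurableI => //; exact: measurable_itv.
  congr (_ * _)%E; rewrite /Defs.mu01 /= /mrestr; congr leb.
  have dilE y : n%:R / b%:R + b%:R^-1 * y = dil b n y :> R.
    by rewrite /dil mulrDr addrC (mulrC n%:R).
  have dil_in (y : R) : (n%:R / b%:R <= dil b n y < n.+1%:R / b%:R) = (0 <= y < 1).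
    by rewrite /dil [b%:R^-1 * _]mulrC ler_pM2r// ltr_pM2r// lerDr -natr1 [y + _]addrC ltrD2l.
  by apply/seteqP; split=> y /=; rewrite dilE !in_itv /= dil_in.
rewrite -part divff ?pnatr_eq0 -?lt0n// /Defs.mu01 /= /mrestr //.
Qed.

Local Open Scope ereal_scope.

(** By [mu01_dil] the measure is the sum of its pushforwards under [dil b k], scaled by 1/b;
    integrate against that sum. *)
Lemma ge0_integral_mu01_dil (b : nat) (F : measurableTypeR R -> \bar R) : (0 < b)%N ->
  measurable_fun setT F -> (forall x, 0 <= F x) ->
  \int[mu01]_x F x = \sum_(k < b) (b%:R^-1)%:E * \int[mu01]_x F (dil b k x).
Proof.
move=> b0 mF F0.
have bV0 : (0 <= b%:R^-1 :> R)%R by rewrite invr_ge0.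
pose pf (k : nat) : {measure set (measurableTypeR R) -> \bar R} :=
  pushforward mu01 (dil b k : measurableTypeR R -> measurableTypeR R).
pose m k : {measure set (measurableTypeR R) -> \bar R} :=
  mscale (NngNum bV0) (pf (@measurable_dil R b) k).
rewrite (@eq_measure_integral _ _ _ _ (msum m b)); last first.
  by move=> A mA _; rewrite (mu01_dil b _ b0 mA).
rewrite ge0_integral_measure_sum//; apply: eq_bigr => k _.
rewrite ge0_integral_mscale//; congr (_ * _).
by rewrite ge0_integral_pushforward//; exact: measurable_dil.
Qed.

(** The induction step for V_{b,d,S} being inside L^p: integrability of f is tested on its b
    rescaled pieces. *)
Lemma Lp_dil (b : nat) (p : \bar R) (f : M01 R) : (0 < b)%N -> 0 < p ->
  (forall k : 'I_b, Lp p (Mcomp f (dil b k))) -> Lp p f.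
Proof.
move=> b0 p0 Lf; rewrite -(cls_repr f).
have pNy : p != -oo by case: p p0 {Lf}.
have {}Lf (k : 'I_b) : 'N[mu01]_p[EFin \o (repr f \o dil b k)] < +oo.
  by move: (Lf k); rewrite -{1}(cls_repr f) dil_cls /Lp /= Lpnorm_cls.
rewrite /Lp /= Lpnorm_cls//.
case: p p0 pNy Lf => [r|_|//]; rewrite ?lte_fin.
  (* Finiteness is tested on the integral of |f|^r, which is additive over the pieces for every r >
     0, including r < 1. *)
  move=> r0 _ Lf; rewrite unlock; apply: poweR_lty.
  rewrite (@ge0_integral_mu01_dil b)//; last 2 first.
    apply: (measurableT_comp (measurable_poweR _)).
    by apply: measurableT_comp => //; apply/measurable_EFinP.
    by move=> x; exact: poweR_ge0.
  apply: lte_sum_pinfty => k _; apply: lte_mul_pinfty => //.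
  by have := poweR_lty r (Lf k); rewrite poweR_Lnorm ?gt_eqF.
move=> _ Lf; rewrite unlock /Lnorm; case: ifPn => // mu0.
(* For p = +oo the candidate bound is the largest essential supremum among the dilates. *)
pose e := \big[Order.max/0%E]_(k < b) ess_sup mu01 (abse \o (EFin \o (repr f \o dil b k))).
apply: (@le_lt_trans _ _ e); last first.
  apply: bigmax_lt => // k _.
  by have := Lf k; rewrite unlock /Lnorm mu0.
have mabs (u : {mfun measurableTypeR R >-> R}) :
    measurable_fun [set: measurableTypeR R] (abse \o (EFin \o u)).
  by apply: measurableT_comp => //; apply/measurable_EFinP.
(* It remains to see that |f| > e only on a null set; by [mu01_dil] this follows from its preimages
   being null, and these are the sets where a dilate exceeds e. *)
apply/ess_supP; apply/ae_le_measureP => //.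
rewrite (mu01_dil b)//; last first.
  by rewrite -[X in measurable X]setTI; apply: (mabs (repr f)) => //; exact: emeasurable_itv.
apply: big1 => k _.
suff -> : mu01 (dil b k @^-1` ((abse \o (EFin \o repr f)) @^-1` `]e, +oo[)) = 0.
  by rewrite mule0.
apply: (ae_le_measureP mu01 (f := abse \o (EFin \o (repr f \o dil b k))) e _).1; first exact: (mabs (repr f \o dil b k)).
apply/ess_supP; exact: le_bigmax.
Qed.

End self_similarity.

(** * Sampling on the b-adic grid *)

Section grid.
Context {R : realType}.
Implicit Types (x : R) (n b : nat).
Local Notation mu01 := (mu01 R).
Local Notation leb := (@lebesgue_measure R).

Lemma ae_mu01 (P : R -> Prop) :
  (forall x, 0 <= x < 1 -> P x) -> {ae mu01, forall x, P x}.
Proof.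
move=> PP; exists (~` `[0, 1[); split.
- by apply: measurableC; exact: measurable_itv.
- by rewrite /Defs.mu01 /= /mrestr setICl measure0.
- by move=> x nPx /=; rewrite in_itv /= => /PP.
Qed.

Lemma eq_cls (u v : {mfun measurableTypeR R >-> R}) :
  (forall x, 0 <= x < 1 -> u x = v x) -> cls u = cls v.
Proof. by move=> uv; apply/clsP; apply: ae_mu01 => x /uv ux _. Qed.

(** Passes to a Lebesgue integral over [0,1), the setting in which continuous approximation is
    carried out. *)
Lemma ge0_integral_mu01E (F : measurableTypeR R -> \bar R) :
  measurable_fun setT F -> (forall x, (0 <= F x)%E) ->
  (\int[mu01]_x F x = \int[leb]_(x in `[0%R, 1%R[) F x)%E.
Proof.
move=> mF F0.
have mI : measurable (`[0, 1[%classic : set (measurableTypeR R)) by exact: measurable_itv.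
transitivity (\int[mu01]_(x in `[0%R, 1%R[) F x)%E; last first.
  by apply: eq_measure_integral => A mA AI; rewrite /Defs.mu01 /= /mrestr setIidl.
rewrite (@ge0_negligible_integral _ _ _ mu01 setT (~` `[0, 1[))//.
- by rewrite setDE setCK setTI.
- by apply: measurableC.
- by rewrite /Defs.mu01 /= /mrestr setICl measure0.
Qed.

(** For b > 0, the left endpoint of the cell of mesh b^-n containing x; on [0,1) it cuts the b-adic
    expansion after n digits. *)
Definition grid b n x : R := (Num.floor (b%:R ^+ n * x))%:~R / b%:R ^+ n.

Lemma measurable_grid b n :
  measurable_fun [set: measurableTypeR R] (grid b n : _ -> measurableTypeR R).
Proof.
apply: nondecreasing_measurable => // x y xy.
by rewrite ler_wpM2r ?invr_ge0 ?exprn_ge0// ler_int le_floor// ler_wpM2l// exprn_ge0.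
Qed.

HB.instance Definition _ b n := isMeasurableFun.Build _ _ _ _
  (grid b n : measurableTypeR R -> measurableTypeR R) (measurable_grid b n).

(** Prefixing a digit commutes with truncation: b^(n+1) [dil b k x] = b^n x + b^n k, and the integer
    b^n k comes out of the floor. *)
Lemma grid_dil b n k x : (0 < b)%N -> grid b n.+1 (dil b k x) = dil b k (grid b n x).
Proof.
move=> b0; have bN0 : b%:R != 0 :> R by rewrite pnatr_eq0 -lt0n.
have bnk : (b%:R ^+ n * k%:R : R) \is a Num.int.
  by rewrite -natrX -natrM; exact: intr_nat.
rewrite /grid /dil exprSr -mulrA mulVKf// mulrDr floorDrz// intrD (floorK bnk).
rewrite invfM mulrA [RHS]mulrC mulrDl; congr (_ / _).
by rewrite mulrAC divff ?mul1r ?expf_neq0.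
Qed.

Lemma grid_le b n x : (0 < b)%N -> grid b n x <= x.
Proof.
move=> b0; rewrite /grid ler_pdivrMr ?exprn_gt0 ?ltr0n// [x * _]mulrC.
exact: floor_le.
Qed.

Lemma grid_gt b n x : (0 < b)%N -> x - b%:R^-1 ^+ n < grid b n x.
Proof.
move=> b0; have bn0 : 0 < b%:R ^+ n :> R by rewrite exprn_gt0 ?ltr0n.
rewrite /grid ltr_pdivlMr// mulrBl exprVn mulVf ?gt_eqF// ltrBlDr mulrC.
by rewrite -intrD1; exact: floorD1_gt.
Qed.

Lemma grid_ge0 b n x : 0 <= x -> 0 <= grid b n x.
Proof.
move=> x0; rewrite divr_ge0 ?exprn_ge0// ler0z floor_ge0.
by rewrite mulr_ge0 ?exprn_ge0.
Qed.

Lemma grid_cvg b x : (1 < b)%N -> grid b n x @[n --> \oo] --> x.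
Proof.
move=> b1; have b0 : (0 < b)%N by exact: ltnW.
apply: (@squeeze_cvgr _ _ _ _ (fun n => x - b%:R^-1 ^+ n) (fun=> x)).
- by apply: nearW => n; rewrite grid_le// andbT ltW// grid_gt.
- rewrite -[X in _ --> X]subr0; apply: cvgB; first exact: cvg_cst.
  by apply: cvg_expr; rewrite ger0_norm ?invr_ge0// invf_lt1 ?ltr1n ?ltr0n.
- exact: cvg_cst.
Qed.

(** A sampled function is constant on every cell. In the induction [phi] is generalized, because a
    dilation turns it into [phi \o dil b k] by [grid_dil]. *)
Lemma V_grid b n (S : set (M01 R)) (phi : {mfun measurableTypeR R >-> R}) :
  (0 < b)%N -> submod_closed (mem S) -> S (cls (cst 1)) ->
  V b n S (cls (phi \o grid b n)).
Proof.
move=> b0 [S0 SD] S1; elim: n phi => [|n IH] phi.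
  (* On [0,1) the grid of mesh 1 returns 0, leaving a constant; the [+ 0] gives the shape
     [a *: f + g] of [submod_closed]. *)
  rewrite V0; have -> : cls (phi \o grid b 0) = phi 0 *: cls (cst 1) + 0.
    rewrite addr0 -[RHS]/(M01_scale _ _) clsZ; apply: eq_cls => x x01 /=.
    have fx : Num.floor x = 0 by apply/eqP; rewrite floor_eq add0r.
    by rewrite /grid expr0 mul1r divr1 fx; exact/esym/mulr1.
  by rewrite -in_setE; apply: SD => //; rewrite inE.
apply/V_succ => k; rewrite dil_cls.
rewrite (_ : cls _ = cls ((phi \o dil b k : {mfun measurableTypeR R >-> R}) \o grid b n)).
  exact: IH.
by congr cls; apply/mfuneqP => x /=; rewrite grid_dil.
Qed.

End grid.

(** * Approximation in L^p by functions sampled on the grid *)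

Section density.
Context {R : realType}.
Implicit Types (x y M e : R) (b n : nat).
Local Notation mu01 := (mu01 R).
Local Notation leb := (@lebesgue_measure R).

Lemma cvge0_lt (u : nat -> \bar R) e :
  u @ \oo --> 0%E -> 0 < e -> exists n, (u n < e%:E)%E.
Proof.
move=> /fine_cvgP[ufin /cvgr0Pnorm_lt u0] e0.
have [n _ un] : \forall n \near \oo, u n \is a fin_num /\ `|fine (u n)| < e.
  by near=> n; split; near: n => //; exact: u0.
exists n; have [ufn une] := un n (leqnn n).
by rewrite -(fineK ufn) lte_fin (le_lt_trans (ler_norm _)).
Unshelve. all: by end_near. Qed.

Definition clamp M x : R := Num.max (- M) (Num.min M x).

Lemma measurable_clamp M :
  measurable_fun [set: measurableTypeR R] (clamp M : _ -> R).
Proof.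
apply: measurable_maxr; first exact: measurable_cst.
by apply: measurable_minr; [exact: measurable_cst|exact: measurable_id].
Qed.

HB.instance Definition _ M := isMeasurableFun.Build _ _ _ _
  (clamp M : measurableTypeR R -> R) (measurable_clamp M).

(** The three-way split after which the later bounds on [clamp] are linear arithmetic. *)
Lemma clampP M x : 0 <= M ->
  [\/ x < - M /\ clamp M x = - M, - M <= x <= M /\ clamp M x = x | M < x /\ clamp M x = M].
Proof.
move=> M0; rewrite /clamp; have [Mx|xM] := ltP M x.
  by apply: Or33; split=> //; apply: max_r; lra.
have [xNM|NMx] := ltP x (- M).
  exact: Or31.
by apply: Or32; split=> //; apply/andP.
Qed.

Lemma clamp_norm M x : 0 <= M -> `|clamp M x| <= M.
Proof. by move=> M0; rewrite ler_norml; case: (clampP M x M0) => -[? ->]; lra. Qed.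

Lemma clamp_id M x : `|x| <= M -> clamp M x = x.
Proof.
move=> xM; have M0 := le_trans (normr_ge0 x) xM; move: xM; rewrite ler_norml.
by case: (clampP M x M0) => -[? ->]; lra.
Qed.

(** Clamping an approximant therefore does not increase its distance to a function already bounded
    by M. *)
Lemma clamp_lipschitz M x y : 0 <= M -> `|clamp M x - clamp M y| <= `|x - y|.
Proof.
move=> M0; suff H x' y' : x' <= y' -> `|clamp M x' - clamp M y'| <= `|x' - y'|.
  by have [/H //|/ltW/H] := leP x y; rewrite distrC [leRHS]distrC.
move=> xy; rewrite [leRHS]distrC (ger0_norm (_ : 0 <= y' - x')) ?subr_ge0// ler_norml.
by case: (clampP M x' M0) => -[? ->]; case: (clampP M y' M0) => -[? ->]; lra.
Qed.

(** Provides the dominating function |u|^r for the truncation errors. *)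
Lemma clamp_dist M x : 0 <= M -> `|x - clamp M x| <= `|x|.
Proof.
move=> M0; have [x0|x0] := leP 0 x;
rewrite ?(ger0_norm x0) ?(ltr0_norm x0) ler_norml;
by case: (clampP M x M0) => -[? ->]; lra.
Qed.

(** Dominated convergence: the samples converge pointwise by continuity, and grid points of [0,1)
    stay in the compact [0,1], where |g| has a bound C. *)
Lemma grid_L1 b (g : R -> R) e : (1 < b)%N -> continuous g -> 0 < e ->
  exists n, (\int[leb]_(x in `[0%R, 1%R[) `|(g x - g (grid b n x))%:E| < e%:E)%E.
Proof.
move=> b1 cg e0; have b0 : (0 < b)%N by exact: ltnW.
have mg : measurable_fun [set: measurableTypeR R] (g : measurableTypeR R -> measurableTypeR R).
  exact: continuous_measurable_fun.
have [C gC] : exists C, forall x, 0 <= x <= 1 -> `|g x| <= C.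
  have cng : {within `[0, 1], continuous (fun x => `|g x|)}.
    by apply: continuous_subspaceT => x; apply: cvg_norm; exact: cg.
  have [c _ cP] := EVT_max (@ler01 R) cng.
  by exists `|g c| => x x01; apply: cP; rewrite in_itv.
pose D : set (measurableTypeR R) := `[0, 1[%classic.
have mD : measurable D by exact: measurable_itv.
have [] := @dominated_convergence _ _ _ leb D mD
  (fun n x => (g (grid b n x))%:E) (EFin \o g) (cst C%:E).
- move=> n; apply/measurable_EFinP; apply: (@measurable_funS _ _ _ _ setT) => //.
  exact: (measurableT_comp mg (measurable_grid b n)).
- by apply/measurable_EFinP; apply: (@measurable_funS _ _ _ _ setT).
- apply: aeW => x _ /=; apply: cvg_EFin; first exact: nearW.
  apply: continuous_cvg; [exact: cg|exact: grid_cvg].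
- apply/integrableP; split; first exact: measurable_cst.
  by rewrite integral_cst//= /D lebesgue_measure_itv /= lte_fin ltr01 oppr0 adde0 mule1 ltry.
- apply: aeW => x n; rewrite /D /= in_itv /= => /andP[x0 x1].
  rewrite lee_fin gC// grid_ge0//= (le_trans (grid_le _ _ _ b0))// ltW//.
move=> _ cv _; have [n nP] := cvge0_lt _ _ cv e0; exists n.
apply: le_lt_trans nP; rewrite le_eqVlt; apply/predU1P; left.
by apply: eq_integral => x _; rewrite -EFinB !abse_EFin distrC.
Qed.

Lemma bounded_approx_L1 b M (v : {mfun measurableTypeR R >-> R}) e :
  (1 < b)%N -> 0 <= M -> (forall x, `|v x| <= M) -> 0 < e ->
  exists n (phi : {mfun measurableTypeR R >-> R}), (forall x, `|phi x| <= M) /\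
    (\int[mu01]_x `|(v x - phi (grid b n x))%:E| < e%:E)%E.
Proof.
move=> b1 M0 vM e0.
pose D : set (measurableTypeR R) := `[0, 1[%classic.
have mD : measurable D by exact: measurable_itv.
have Dfin : (leb D < +oo)%E.
  by rewrite /D lebesgue_measure_itv /= lte_fin ltr01 oppr0 adde0 ltry.
have mS (w : measurableTypeR R -> R) :
    measurable_fun [set: measurableTypeR R] w -> measurable_fun D w.
  by move=> mw; apply: (@measurable_funS _ _ _ _ setT).
have iv : leb.-integrable D (EFin \o v).
  apply: (@measurable_bounded_integrable _ (measurableTypeR R) _ leb v D) => //.
    exact: mS.
  exists M; split; first exact: num_real.
  by move=> N MN x _; exact: (le_trans (vM x) (ltW MN)).
have [g_ [cg ig vg]] := @approximation_continuous_integrable R D v mD Dfin iv.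
have [m gm] := cvge0_lt _ _ vg (divr_gt0 e0 (ltr0n _ 2)).
have [n gn] := grid_L1 b (g_ m) _ b1 (cg m) (divr_gt0 e0 (ltr0n _ 2)).
have mg : measurable_fun [set: measurableTypeR R] (g_ m : measurableTypeR R -> measurableTypeR R).
  exact: continuous_measurable_fun.
pose g : {mfun measurableTypeR R >-> measurableTypeR R} :=
  HB.pack (g_ m : measurableTypeR R -> measurableTypeR R) (isMeasurableFun.Build _ _ _ _ _ mg).
pose cM : {mfun measurableTypeR R >-> R} := clamp M.
(* The continuous approximant need not be bounded by M, so it is clamped before sampling. *)
exists n, (cM \o g); split=> [x|]; first exact: clamp_norm.
rewrite ge0_integral_mu01E//; last first.
  apply: measurableT_comp => //; apply/measurable_EFinP.
  apply: measurable_funB => //.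
  apply: (measurableT_comp (measurable_clamp M)).
  exact: (measurableT_comp mg (measurable_grid b n)).
have mE (w : measurableTypeR R -> R) : measurable_fun [set: measurableTypeR R] w ->
    measurable_fun D (fun x => `|(w x)%:E|%E).
  by move=> mw; apply: measurableT_comp => //; apply/measurable_EFinP; exact: mS.
have mgn : measurable_fun [set: measurableTypeR R] (fun x => g (grid b n x) : R).
  exact: (measurableT_comp mg (measurable_grid b n)).
have mvg : measurable_fun D (fun x => `|(v x - g x)%:E|%E).
  by apply: (mE (fun x => v x - g x)); exact: measurable_funB.
have mgg : measurable_fun D (fun x => `|(g x - g (grid b n x))%:E|%E).
  by apply: (mE (fun x => g x - g (grid b n x))); exact: measurable_funB.
apply: (@le_lt_trans _ _ (\int[leb]_(x in D) (`|(v x - g x)%:E| + `|(g x - g (grid b n x))%:E|))%E).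
  apply: ge0_le_integral => //.
  - apply: (mE (fun x => v x - clamp M (g (grid b n x)))); apply: measurable_funB => //.
    exact: (measurableT_comp (measurable_clamp M) mgn).
  - exact: emeasurable_funD.
  - move=> x _; rewrite !abse_EFin -EFinD lee_fin.
    (* Since |v| is at most M, v x is its own clamp, and the Lipschitz bound removes both clamps;
       the triangle inequality through g x follows. *)
    rewrite -{1}(clamp_id M (v x))//; apply: (le_trans (clamp_lipschitz _ _ _ M0)).
    by rewrite -(subrKA (g x)) ler_normD.
rewrite ge0_integralD//.
by rewrite [e]splitr EFinD lteD.
Qed.

(* On values bounded by 2M, |w|^r <= (2M)^(r-1) |w|. *)
Lemma bounded_approx_Lp b M r (v : {mfun measurableTypeR R >-> R}) e :
  (1 < b)%N -> 0 < M -> 1 <= r -> (forall x, `|v x| <= M) -> 0 < e ->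
  exists n (phi : {mfun measurableTypeR R >-> R}),
    (\int[mu01]_x ((`|v x - phi (grid b n x)| `^ r)%:E) < e%:E)%E.
Proof.
move=> b1 M0 r1 vM e0; pose c := (M + M) `^ (r - 1).
have c0 : 0 < c by rewrite powR_gt0// addr_gt0.
have [n [phi [phiM L]]] := bounded_approx_L1 b M v _ b1 (ltW M0) vM (divr_gt0 e0 c0).
exists n, phi.
have mw : measurable_fun [set: measurableTypeR R] (fun x => v x - phi (grid b n x)).
  by apply: measurable_funB => //; exact: (measurableT_comp (measurable_funPT phi) (measurable_grid b n)).
apply: (@le_lt_trans _ _ (\int[mu01]_x (c%:E * `|(v x - phi (grid b n x))%:E|))%E).
  apply: ge0_le_integral => //.
  - apply/measurable_EFinP; apply: (measurableT_comp (measurable_powR r)).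
    exact: measurableT_comp.
  - apply: measurable_funeM; apply: measurableT_comp => //; exact/measurable_EFinP.
  - move=> x _; rewrite abse_EFin -EFinM lee_fin.
    have wM : `|v x - phi (grid b n x)| <= M + M.
      by rewrite (le_trans (ler_normB _ _))// lerD.
    rewrite -[in leLHS](subrK 1 r) powRD; last by rewrite subrK gt_eqF// (lt_le_trans ltr01).
    have MM0 : 0 <= M + M by rewrite addr_ge0 ?ltW.
    by rewrite powRr1// ler_wpM2r// ge0_ler_powR ?subr_ge0 ?nnegrE.
rewrite ge0_integralZl_EFin//; last 2 first.
- by apply: measurableT_comp => //; exact/measurable_EFinP.
- exact: ltW.
by move: L; rewrite mulrC EFinM lte_pdivlMl.
Qed.

Lemma Lnorm_lt r (w : measurableTypeR R -> R) e : 0 < r -> 0 < e ->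
  (\int[mu01]_x (`|w x| `^ r)%:E < (e `^ r)%:E)%E -> ('N[mu01]_r%:E[EFin \o w] < e%:E)%E.
Proof.
move=> r0 e0 wr; rewrite ltNge; apply/negP => ew; move: wr; apply/negP; rewrite -leNgt.
have -> : (\int[mu01]_x (`|w x| `^ r)%:E = 'N[mu01]_r%:E[EFin \o w] `^ r)%E.
  by rewrite poweR_Lnorm ?gt_eqF.
rewrite -poweR_EFin; apply: (gt0_ler_poweR (ltW r0)) => //.
  by rewrite in_itv /= leey lee_fin ltW.
by rewrite in_itv /= leey Lnorm_ge0.
Qed.

(** Dominated convergence along the levels M = n+1, which are positive from the start. *)
Lemma clamp_approx_Lp r (u : {mfun measurableTypeR R >-> R}) e :
  0 < r -> ('N[mu01]_r%:E[EFin \o u] < +oo)%E -> 0 < e ->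
  exists M, 0 < M /\ (\int[mu01]_x (`|u x - clamp M (u x)| `^ r)%:E < e%:E)%E.
Proof.
move=> r0 uoo e0.
have mp (w : measurableTypeR R -> R) : measurable_fun [set: measurableTypeR R] w ->
    measurable_fun [set: measurableTypeR R] (fun x => (`|w x| `^ r)%:E).
  move=> mw; apply/measurable_EFinP; apply: (measurableT_comp (measurable_powR r)).
  exact: measurableT_comp.
have mc n : measurable_fun [set: measurableTypeR R] (fun x => u x - clamp n.+1%:R (u x)).
  apply: measurable_funB => //.
  exact: (measurableT_comp (measurable_clamp _) (measurable_funPT u)).
have [] := @dominated_convergence _ _ _ mu01 setT measurableT
  (fun n x => (`|u x - clamp n.+1%:R (u x)| `^ r)%:E) (cst 0%E) (fun x => (`|u x| `^ r)%:E).
- by move=> n; exact: mp.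
- exact: measurable_cst.
- apply: aeW => x _ /=; apply: cvg_near_cst.
  (* From this index on, n+1 exceeds |u x|, so clamping leaves u x unchanged and the error is
     exactly 0. *)
  exists (Num.truncn `|u x|) => // n /= xn.
  rewrite clamp_id ?subrr ?normr0 ?powR0 ?gt_eqF//.
  by rewrite (le_trans (ltW (truncnS_gt _)))// ler_nat.
- apply/integrableP; split; first exact: mp.
  have := poweR_lty r uoo; rewrite poweR_Lnorm ?gt_eqF//; apply: le_lt_trans.
  rewrite le_eqVlt; apply/predU1P; left.
  by apply: eq_integral => x _; rewrite gee0_abs ?lee_fin ?powR_ge0.
- apply: aeW => x n _; rewrite gee0_abs ?lee_fin ?powR_ge0//.
  by rewrite ge0_ler_powR ?nnegrE ?clamp_dist// ltW.
move=> _ cv _; have [n nP] := cvge0_lt _ _ cv e0; exists n.+1%:R; split=> //.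
apply: le_lt_trans nP; rewrite le_eqVlt; apply/predU1P; left.
by apply: eq_integral => x _; rewrite sube0 gee0_abs ?lee_fin ?powR_ge0.
Qed.

Lemma step_dense b r (f : M01 R) e : (1 < b)%N -> 1 <= r -> Lp r%:E f -> 0 < e ->
  exists n (phi : {mfun measurableTypeR R >-> R}),
    (Lpnorm r%:E (f - cls (phi \o grid b n))%R < e%:E)%E.
Proof.
move=> b1 r1 fr e0; have r0 : 0 < r by exact: lt_le_trans r1.
have e2 : 0 < e / 2 by rewrite divr_gt0.
(* The two errors are controlled as integrals of r-th powers; the threshold (e/2)^r corresponds to a
   norm of e/2. *)
have e2r : 0 < (e / 2) `^ r by rewrite powR_gt0.
pose u := repr f; have uoo : ('N[mu01]_r%:E[EFin \o u] < +oo)%E by exact: fr.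
have [M [M0 uM]] := clamp_approx_Lp r u _ r0 uoo e2r.
have mv : measurable_fun [set: measurableTypeR R] (clamp M \o u : measurableTypeR R -> R).
  exact: (measurableT_comp (measurable_clamp M) (measurable_funPT u)).
pose v : {mfun measurableTypeR R >-> R} := HB.pack
  (clamp M \o u : measurableTypeR R -> R) (isMeasurableFun.Build _ _ _ _ _ mv).
have [|n [phi L]] := bounded_approx_Lp b M r v _ b1 M0 r1 _ e2r.
  by move=> x; rewrite clamp_norm// ltW.
exists n, phi; rewrite -(cls_repr f).
have -> : cls u - cls (phi \o grid b n) = cls (u - (phi \o grid b n)).
  by rewrite -clsD -clsN.
rewrite Lpnorm_cls//.
(* Insert the truncation v of u, so that Minkowski, valid as r is at least 1, separates truncation
   error from sampling error. *)
have -> : EFin \o (u - (phi \o grid b n) : {mfun _ >-> _}) =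
    EFin \o ((fun x => u x - clamp M (u x)) \+ (fun x => v x - phi (grid b n x))).
  by apply/funext => x /=; rewrite subrKA.
apply: (@le_lt_trans _ _ _ _ _ (minkowski_EFin mu01 _ _ r1)).
- exact: measurable_funB.
- apply: measurable_funB => //.
  exact: (measurableT_comp (measurable_funPT phi) (measurable_grid b n)).
by rewrite [e]splitr EFinD lteD// Lnorm_lt.
Qed.

End density.

(** * Inclusion in L^p and the conclusion *)

Lemma V_Lp (R : realType) (b d : nat) (p : \bar R) (S : set (M01 R)) :
  (0 < b)%N -> (0 < p)%E -> S `<=` Lp p -> V b d S `<=` Lp p.
Proof.
move=> b0 p0 SLp; elim: d => [|d IH] f; first by rewrite V0; exact: SLp.
by move=> /V_succ Vf; apply: (Lp_dil b) => // k; exact: IH.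
Qed.

Theorem mainTheorem2 (R : realType) (b : nat) (p : \bar R) (S : set (M01 R))
    (b_ge2 : (2 <= b)%N) (p_gt0 : (0 < p)%E)
    (S_Lp : S `<=` Lp p) (S_lin : submod_closed (mem S)) (S_fin : finite_dim S)
    (S_dil : dilation_closed b S) :
  [/\ V b 0 S = S,
      forall d : nat, V b d S `<=` V b d.+1 S,
      forall d : nat, V b d S `<=` Lp p /\ submod_closed (mem (V b d S)),
      submod_closed (mem (Vinf b S)) &
      S (cls (cst 1)) -> (1 <= p)%E -> (p < +oo)%E -> dense_in_Lp p (Vinf b S)].
Proof.
have b0 : (0 < b)%N by exact: ltnW.
split.
- exact: V0.
- by move=> d; exact: V_subset.
- by move=> d; split; [exact: V_Lp|exact: V_submod_closed].
- exact: Vinf_submod_closed.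
move=> S1 p1 poo; split; first by move=> f [d _]; exact: V_Lp.
case: p p_gt0 S_Lp p1 poo => [r|//|//] _ _ r1 _ f fLp e e0.
have [n [phi L]] := step_dense b r f e b_ge2 r1 fLp e0.
(* Sampling at mesh b^-n lands in level n, as S contains the constants. *)
by exists (cls (phi \o grid b n)) => //; exists n => //; exact: V_grid.
Qed.
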